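(* Let $R,R'$ be (untyped) proof-structures such that $R\to_{\mathtt{cut}}R'$ (one step of cut elimination). If $R\models \mathsf{ACC}_{\sharp\mathsf w}$, then $R'\models \mathsf{ACC}_{\sharp\mathsf w}$.
   Context: Graphs. A graph $G$ consists of finite disjoint sets $N(G)$ (nodes), $A(G)$ (arcs) and functions $\mathrm{tail},\mathrm{head}:A(G)\to N(G)$ (loops and parallel arcs allowed). An arc $a$ is a conclusion of $\mathrm{tail}(a)$ and a premise of $\mathrm{head}(a)$; its ends are $\mathrm{tail}(a),\mathrm{head}(a)$. A path from $n_0$ to $n_k$ is an alternating sequence $n_0a_1n_1\dots a_kn_k$ ($k\ge 0$) of nodes and arcs such that the ends of $a_i$ are $n_{i-1}$ and $n_i$; $n_i=n_j$ with $i\ne j$ implies $\{i,j\}=\{0,k\}$; and $a_1\neq a_k$ if $k\ge2$. It is a cycle if $k>0$ and $n_0=n_k$. $G$ is acyclic if it has no cycle (orientation of arcs is ignored). $\mathrm{cc}(G)$ is the set of (non-empty) connected components of $G$; $\sharp S$ is the cardinality of $S$. Ground-structures. Write $\wp$ for par. A ground-structure is a graph whose nodes carry labels in $\{\mathtt{ax},\mathtt{cut},\mathtt 1,\bot,\otimes,\wp,!,?\mathtt d,?,\bullet\}$ with the following numbers of premises and conclusions: $\mathtt{ax}$: 0 premises, 2 conclusions; $\mathtt{cut}$: 2, 0; $\mathtt 1$ and $\bot$: 0, 1; $\otimes$ and $\wp$: 2, 1; $!$: 0 premises, at least 1 conclusion; $?\mathtt d$: 1, 1; $?$: any number $k\ge0$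 of premises, 1 conclusion; $\bullet$: 1, 0. It is equipped with a total order on the set of premises of its $\bullet$ nodes (these arcs are the conclusions of the ground-structure), on the conclusions of each $!$ node, and on the premises of each $\otimes$ and $\wp$ node (left, right premise). The greatest conclusion of a $!$ node is its principal port, the others its auxiliary ports. A $?$ node with $0$ premises is a $?\mathtt w$ node; with at least $2$ premises a $?\mathtt c$ node. $\mathsf w(\mathcal G)$ is the set of $\bot$ and $?\mathtt w$ nodes of $\mathcal G$. Proof-structures. A proof-structure (of finite depth, inductively) is a pair $R=(\mathcal G_R,\mathrm{box}_R)$ where $\mathcal G_R$ is a ground-structure and $\mathrm{box}_R$ maps each $!$ node $n$ of $\mathcal G_R$ to a proof-structure $\mathrm{box}_R(n)$ (its box) whose ground-structure has as many conclusions as $n$ (the $i$-th conclusion of the box corresponding to the $i$-th conclusion of $n$), all the sets of nodes and arcs involved being pairwise disjoint. Write $R'\sqsubset R$ if $R'=\mathrm{box}_R(n)$ for some $!$ node $n$ of $\mathcal G_R$. Proof-structures are considered up to renaming of nodes and arcs. The property. A switching $\varphi$ of $\mathcal G$ maps each $\wp$ or $?\mathtt c$ node $n$ to one of its premises; $\mathcal G^\varphi$ is the graph obtained by erasing, for each $\wp$ or $?\mathtt c$ node $n$, every premise of $n$ except $\varphi(n)$. $\mathcal G\models\mathsf{ACC}_{\sharp\mathsf w}$ if for every switching $\varphi$ the graph $\mathcal G^\varphi$ is acyclic and $\sharp\mathrm{cc}(\mathcal G^\varphi)=\sharp\mathsf w(\mathcal G)+1$. $R\models\mathsf{ACC}_{\sharp\mathsf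 w}$ if $\mathcal G_R\models\mathsf{ACC}_{\sharp\mathsf w}$ and, inductively, $R'\models\mathsf{ACC}_{\sharp\mathsf w}$ for all $R'\sqsubset R$. Cut elimination. $R\to_{\mathtt{cut}}R'$ if $R'$ is obtained by applying one of the following steps in $\mathcal G_R$, or (inductively) by performing a step inside one box of $R$, everything else being unchanged. For a $\mathtt{cut}$ node $c$ of $\mathcal G_R$: (ax) if one premise of $c$ is a conclusion of an $\mathtt{ax}$ node $m$, the other premise $b$ of $c$ is not a conclusion of $m$, and $a$ is the other conclusion of $m$: erase $m$ and $c$, and fuse $b$ and $a$ into one arc with the tail of $b$ and the head of $a$. ($\mathtt 1/\bot$) if the premises of $c$ are the conclusions of a $\mathtt 1$ node and a $\bot$ node: erase these three nodes and two arcs. ($\otimes/\wp$) if the premises of $c$ are the conclusions of a $\otimes$ node and a $\wp$ node: erase the three nodes and the two conclusions; add a $\mathtt{cut}$ node with premises the left premises of the $\otimes$ and of the $\wp$, and a $\mathtt{cut}$ node with premises their right premises. ($!/?\mathtt d$) if the premises of $c$ are the principal port of a $!$ node $n$ and the conclusion of a $?\mathtt d$ node: open the box, i.e. erase $n$ and the $?\mathtt d$ node, insert the content of $\mathrm{box}_R(n)$ (ground-structure and its nested boxes) in $\mathcal G_R$, its conclusions corresponding to auxiliary ports of $n$ replacing those auxiliary ports, and let $c$ have as premises the last conclusion of $\mathrm{box}_R(n)$ and the premise of the $?\mathtt d$ node. ($!/?$) if the premises of $c$ are the principal port of a $!$ node $n$ with $h$ auxiliary ports and the conclusion of a $?$ node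 with $k\ge0$ premises: erase $c$ and the $?$ node, replace $n$ by $k$ copies of $n$ with (disjoint) copies of its box, the principal port of the $j$-th copy being cut (by a new $\mathtt{cut}$ node) against the $j$-th premise of the erased $?$ node; for each $i\le h$ add a new $?$ node whose premises are the $i$-th auxiliary ports of the $k$ copies and whose conclusion replaces the $i$-th auxiliary port of $n$. ($!/!$) if the premises of $c$ are the principal port of a $!$ node $n$ and the $i$-th auxiliary port of a $!$ node $m\neq n$: erase $c$ and $n$ from $\mathcal G_R$; inside the box of $m$ add the $!$ node $n$ with its box, and a $\mathtt{cut}$ node between the principal port of $n$ and the $i$-th conclusion of the box of $m$; the auxiliary ports of $n$ become conclusions of the box of $m$ in place of its $i$-th one, and correspondingly the former auxiliary ports of $n$ in $\mathcal G_R$ become auxiliary ports of $m$ in place of its $i$-th one. *)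

(* Defs.v *)
From HB Require Import structures.
From mathcomp Require Import all_boot.

Set Implicit Arguments.
Unset Strict Implicit.
Unset Printing Implicit Defensive.

(** * Graphs *)

(* Nodes and arcs live in two distinct finite types, so that they are disjoint
   by construction. *)
Record graph := Graph {
  node : finType;
  arc : finType;
  atail : arc -> node;
  ahead : arc -> node }.

Section GraphTheory.
Variable G : graph.
Implicit Types (a : arc G) (x y n : node G).

Definition premises n : {set arc G} := [set a | ahead a == n].
Definition conclusions n : {set arc G} := [set a | atail a == n].

Definition ends a x y : bool :=
  ((atail a == x) && (ahead a == y)) || ((atail a == y) && (ahead a == x)).

(* The alternating sequence n_0 a_1 n_1 ... a_k n_k is encoded by n_0 and
   p = [:: (a_1, n_1); ...; (a_k, n_k)], so that k = size p. *)
Fixpoint walk x (p : seq (arc G * node G)) : bool :=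
  if p is (a, y) :: p' then ends a x y && walk y p' else true.

Definition is_path x (p : seq (arc G * node G)) : Prop :=
  [/\ walk x p,
      forall i j, i < j <= size p ->
        nth x (x :: unzip2 p) i = nth x (x :: unzip2 p) j ->
        i = 0 /\ j = size p
    & 2 <= size p ->
        forall a0, seq.head a0 (unzip1 p) <> last a0 (unzip1 p)].

Definition is_cycle x (p : seq (arc G * node G)) : Prop :=
  [/\ is_path x p, 0 < size p & last x (unzip2 p) = x].

Definition acyclic : Prop := forall x p, ~ is_cycle x p.

Definition adjacent : rel (node G) := fun x y => [exists a, ends a x y].

(* Each connected component is represented by its (non-empty) set of nodes. *)
Definition cc : {set {set node G}} :=
  equivalence_partition (connect adjacent) [set: node G].

End GraphTheory.

(** * Ground-structures *)

Inductive label := Ax | Cut | One | Bot | Tens | Par | Bang | Der | Why | Bullet.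

Lemma label_comparable : comparable label.
Proof. by case; case; (left; reflexivity) || (right; discriminate). Defined.

HB.instance Definition _ :=
  hasDecEq.Build label (compareP label_comparable).

(* The raw data of a ground-structure. Total orders are given by increasing
   enumerations: [concls] enumerates the premises of all the bullet nodes, and
   [order n] enumerates the conclusions of n if n is a ! node, and the premises
   of n (left, right) if n is a tensor or par node. The value of [order] at
   other nodes is irrelevant. *)
Record preground := PreGround {
  graph_of :> graph;
  lab : node graph_of -> label;
  concls : seq (arc graph_of);
  order : node graph_of -> seq (arc graph_of) }.

Definition ordered_label (l : label) : bool := l \in [:: Tens; Par; Bang].

Section GroundStructures.
Variable G : preground.
Implicit Types (n : node G) (phi : node G -> arc G).

Definition arity_ok n : bool :=
  let p := #|premises n| in
  let c := #|conclusions n| in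
  match lab n with
  | Ax => (p == 0) && (c == 2)
  | Cut => (p == 2) && (c == 0)
  | One | Bot => (p == 0) && (c == 1)
  | Tens | Par => (p == 2) && (c == 1)
  | Bang => (p == 0) && (1 <= c)
  | Der => (p == 1) && (c == 1)
  | Why => c == 1
  | Bullet => (p == 1) && (c == 0)
  end.

Definition ground_structure : Prop :=
  [/\ forall n, arity_ok n,
      uniq (concls G) /\
        (forall a : arc G, (a \in concls G) = (lab (ahead a) == Bullet)),
      forall n, lab n = Bang -> uniq (order n) /\ order n =i conclusions n
    & forall n, lab n \in [:: Tens; Par] ->
        uniq (order n) /\ order n =i premises n].

Definition w_nodes : {set node G} :=
  [set n | (lab n == Bot) || ((lab n == Why) && (#|premises n| == 0))].

(* The par and ?c nodes. *)
Definition switched n : bool :=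
  (lab n == Par) || ((lab n == Why) && (2 <= #|premises n|)).

(* The value of a switching at the nodes that are not switched is irrelevant. *)
Definition is_switching phi : Prop :=
  forall n, switched n -> phi n \in premises n.

Definition switching_graph phi : graph :=
  @Graph (node G)
    {a : arc G | switched (ahead a) ==> (phi (ahead a) == a)}
    (fun a => atail (val a)) (fun a => ahead (val a)).

Definition ground_ACCw : Prop :=
  forall phi, is_switching phi ->
    acyclic (switching_graph phi) /\
    #|cc (switching_graph phi)| = #|w_nodes| + 1.

End GroundStructures.

(** * Proof-structures *)

(* Raw proof-structures. Only the values of the second argument at ! nodes are
   meaningful. The nodes and arcs of the various boxes live in unrelated types,
   so that they are disjoint from each other by construction. *)
Inductive prestruct : Type :=
  PreStruct (G : preground) of (node G -> prestruct).

Coercion ground_of (R : prestruct) : preground := let: PreStruct G _ := R in G.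

Definition box (R : prestruct) : node R -> prestruct :=
  let: PreStruct G b as R0 := R return node R0 -> prestruct in b.

Inductive proof_structure (R : prestruct) : Prop :=
  ProofStructure of
    ground_structure R &
    (forall n : node R, lab n = Bang ->
       proof_structure (box n) /\ size (concls (box n)) = size (order n)).

Definition sub_box (R' R : prestruct) : Prop :=
  exists2 n : node R, lab n = Bang & R' = box n.

Inductive ACCw (R : prestruct) : Prop :=
  ACCwIntro of ground_ACCw R & (forall R', sub_box R' R -> ACCw R').

(** * Renaming and erasing *)

(* (fn, fa) renames the nodes and arcs of G' into the nodes of G satisfying KN
   and the arcs of G satisfying KA, i.e. G' is, up to renaming, what remains of
   G when the other nodes and arcs are erased. *)
Record renaming (G' G : preground) (KN : pred (node G)) (KA : pred (arc G))
    (fn : node G' -> node G) (fa : arc G' -> arc G) : Prop := Renaming {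
  renaming_node_inj : injective fn;
  renaming_arc_inj : injective fa;
  renaming_node : forall v, (v \in codom fn) = KN v;
  renaming_arc : forall a, (a \in codom fa) = KA a;
  renaming_tail : forall a, fn (atail a) = atail (fa a);
  renaming_head : forall a, fn (ahead a) = ahead (fa a);
  renaming_lab : forall n, lab (fn n) = lab n;
  renaming_concls : map fa (concls G') = concls G;
  renaming_order : forall n, ordered_label (lab n) ->
    map fa (order n) = order (fn n) }.

(* Equality of proof-structures up to renaming of nodes and arcs. *)
Fixpoint iso (R' R : prestruct) : Prop :=
  match R', R with
  | PreStruct G' b', PreStruct G b =>
    exists (fn : node G' -> node G) (fa : arc G' -> arc G),
      renaming predT predT fn fa /\
      (forall n, lab n = Bang -> iso (b' n) (b (fn n)))
  end.

(* R' is, up to renaming, what remains of P when only the nodes satisfying KN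
   and the arcs satisfying KA are kept. *)
Definition keeping (P : prestruct) (KN : pred (node P)) (KA : pred (arc P))
    (R' : prestruct) : Prop :=
  exists (fn : node R' -> node P) (fa : arc R' -> arc P),
    renaming KN KA fn fa /\
    (forall n, lab n = Bang -> iso (box n) (box (fn n))).

(** * Cut elimination *)

(* Each [*_graph] below adds nodes and arcs to R and redirects arcs; the nodes
   and arcs to be erased are still present and are removed by [keeping] in the
   definition of the steps. *)

Definition void_struct : prestruct :=
  @PreStruct (@PreGround (@Graph void void id id) (of_void _) [::] (of_void _))
    (of_void _).

(* Fusing b and a: the resulting arc is called a. *)
Definition ax_graph (R : prestruct) (a b : arc R) : prestruct :=
  @PreStruct
    (@PreGround
      (@Graph (node R) (arc R)
        (fun e => if e == a then atail b else atail e)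
        (fun e => ahead e))
      (fun v => lab v)
      (concls R)
      (fun v => [seq if e == b then a else e | e <- order v]))
    (fun v => box v).

(* The new cut nodes are inr true (left) and inr false (right). *)
Definition tens_graph (R : prestruct) (tl tr pl pr : arc R) : prestruct :=
  @PreStruct
    (@PreGround
      (@Graph (node R + bool)%type (arc R)
        (fun e => inl (atail e))
        (fun e => if e \in [:: tl; pl] then inr true
                  else if e \in [:: tr; pr] then inr false
                  else inl (ahead e)))
      (fun v => match v with inl u => lab u | inr _ => Cut end)
      (concls R)
      (fun v => match v with inl u => order u | inr _ => [::] end))
    (fun v => match v with inl u => box u | inr _ => void_struct end).

(* Opening the box of n, where z is the premise of the ?d node and c the cut.
   The i-th conclusion of the box takes the place of the i-th port of n. Since
   the head of the principal port of n is c, the last conclusion of the box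
   becomes a premise of c. *)
Definition open_graph (R : prestruct) (c n : node R) (z : arc R) : prestruct :=
  let B := box n in
  let head' (e : arc R) := if e == z then c else ahead e in
  let subst (e : arc R) : arc R + arc B :=
    nth (inl e) [seq inr d | d <- concls B] (index e (order n)) in
  @PreStruct
    (@PreGround
      (@Graph (node R + node B)%type (arc R + arc B)%type
        (fun e => match e with
                  | inl e => inl (atail e)
                  | inr d => inr (atail d)
                  end)
        (fun e => match e with
                  | inl e => inl (head' e)
                  | inr d => if d \in concls B
                             then inl (head' (nth z (order n)
                                                  (index d (concls B))))
                             else inr (ahead d)
                  end))
      (fun v => match v with inl u => lab u | inr u => lab u end)
      [seq subst e | e <- concls R]
      (fun v => match v with
                | inl u => [seq subst e | e <- order u]
                | inr u => [seq inr d | d <- order u]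
                end))
    (fun v => match v with inl u => box u | inr u => box u end).

(* Nodes and arcs for the duplication of a box. The copies are indexed by the
   premises p of the erased ? node, and the new ? nodes by the auxiliary ports
   of the duplicated ! node. *)
Notation Old v := (inl v) (only parsing).
Notation CopyOf p := (inr (inl p)) (only parsing).
Notation CutAt p := (inr (inr (inl p))) (only parsing).
Notation WhyAt a := (inr (inr (inr a))) (only parsing).
(* The copy, in the p-th copy of the ! node, of its port a. *)
Notation PortCopy p a := (inr (p, a)) (only parsing).

Definition dup_graph (R : prestruct) (n q : node R) (aux : seq (arc R)) :
    prestruct :=
  @PreStruct
    (@PreGround
      (@Graph (node R + (arc R + (arc R + arc R)))%type
              (arc R + arc R * arc R)%type
        (fun e => match e with
                  | Old a => if a \in aux then WhyAt a else Old (atail a)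
                  | PortCopy p _ => CopyOf p
                  end)
        (fun e => match e with
                  | Old a => if ahead a == q then CutAt a else Old (ahead a)
                  | PortCopy p a => if a \in aux then WhyAt a else CutAt p
                  end))
      (fun v => match v with
                | Old u => lab u
                | CopyOf _ => Bang
                | CutAt _ => Cut
                | WhyAt _ => Why
                end)
      [seq Old a | a <- concls R]
      (fun v => match v with
                | Old u => [seq Old a | a <- order u]
                | CopyOf p => [seq PortCopy p a | a <- order n]
                | _ => [::]
                end))
    (fun v => match v with
              | Old u => box u
              | CopyOf _ => box n
              | _ => void_struct
              end).

(* The new box of m: the ! node n = inr None and its ports are added, and
   inr (Some None) is the new cut. The conclusion d of the box (preceded by t1
   and followed by t2) becomes a premise of this cut, and inr (Some (Some a)) is
   the bullet node below the auxiliary port a of n. *)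
Definition enter_box_graph (R : prestruct) (n m : node R) (aux : seq (arc R))
    (t1 : seq (arc (box m))) (d : arc (box m)) (t2 : seq (arc (box m))) :
    prestruct :=
  let B := box m in
  @PreStruct
    (@PreGround
      (@Graph (node B + option (option (arc R)))%type (arc B + arc R)%type
        (fun e => match e with
                  | inl e => inl (atail e)
                  | inr _ => inr None
                  end)
        (fun e => match e with
                  | inl e => if e == d then inr (Some None) else inl (ahead e)
                  | inr a => if a \in aux then inr (Some (Some a))
                             else inr (Some None)
                  end))
      (fun v => match v with
                | inl u => lab u
                | inr None => Bang
                | inr (Some None) => Cut
                | inr (Some (Some _)) => Bullet
                end)
      ([seq inl e | e <- t1] ++ [seq inr a | a <- aux]
         ++ [seq inl e | e <- t2])
      (fun v => match v with
                | inl u => [seq inl e | e <- order u]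
                | inr None => [seq inr a | a <- order n]
                | _ => [::]
                end))
    (fun v => match v with
              | inl u => box u
              | inr None => box n
              | _ => void_struct
              end).

(* The auxiliary ports of n become auxiliary ports of m, between s1 and s2, and
   B' is the new box of m. *)
Definition enter_graph (R : prestruct) (m : node R) (aux s1 s2 : seq (arc R))
    (B' : prestruct) : prestruct :=
  @PreStruct
    (@PreGround
      (@Graph (node R) (arc R)
        (fun e => if e \in aux then m else atail e)
        (fun e => ahead e))
      (fun v => lab v)
      (concls R)
      (fun v => if v == m then s1 ++ aux ++ s2 else order v))
    (fun v => if v == m then B' else box v).

Inductive cut_step : prestruct -> prestruct -> Prop :=
| step_ax (R R' : prestruct) (c m : node R) (a a0 b : arc R) :
    lab c = Cut -> lab m = Ax ->
    a0 != b -> ahead a0 = c -> ahead b = c ->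
    atail a0 = m -> atail b != m -> a != a0 -> atail a = m ->
    @keeping (ax_graph a b)
      (fun v => v \notin [:: c; m]) (fun e => e \notin [:: a0; b]) R' ->
    cut_step R R'
| step_one (R R' : prestruct) (c o p : node R) (x y : arc R) :
    lab c = Cut -> lab o = One -> lab p = Bot ->
    ahead x = c -> ahead y = c -> atail x = o -> atail y = p ->
    @keeping R
      (fun v => v \notin [:: c; o; p]) (fun e => e \notin [:: x; y]) R' ->
    cut_step R R'
| step_tens (R R' : prestruct) (c t p : node R) (x y tl tr pl pr : arc R) :
    lab c = Cut -> lab t = Tens -> lab p = Par ->
    ahead x = c -> ahead y = c -> atail x = t -> atail y = p ->
    order t = [:: tl; tr] -> order p = [:: pl; pr] ->
    @keeping (tens_graph tl tr pl pr)
      (fun v => match v with inl u => u \notin [:: c; t; p] | inr _ => true end)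
      (fun e => e \notin [:: x; y]) R' ->
    cut_step R R'
| step_der (R R' : prestruct) (c n d : node R) (aux : seq (arc R))
    (x y z : arc R) :
    lab c = Cut -> lab n = Bang -> lab d = Der ->
    order n = rcons aux x -> ahead x = c ->
    atail y = d -> ahead y = c -> ahead z = d ->
    @keeping (open_graph c n z)
      (fun v => match v with
                | inl u => u \notin [:: n; d]
                | inr u => lab u != Bullet
                end)
      (fun e => match e with
                | inl e => e \notin y :: order n
                | inr _ => true
                end) R' ->
    cut_step R R'
| step_why (R R' : prestruct) (c n q : node R) (aux : seq (arc R))
    (x y : arc R) :
    lab c = Cut -> lab n = Bang -> lab q = Why ->
    order n = rcons aux x -> ahead x = c ->
    atail y = q -> ahead y = c ->
    @keeping (dup_graph n q aux)
      (fun v => match v with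
                | Old u => u \notin [:: c; n; q]
                | CopyOf p | CutAt p => p \in premises q
                | WhyAt a => a \in aux
                end)
      (fun e => match e with
                | Old a => a \notin [:: x; y]
                | PortCopy p a => (p \in premises q) && (a \in order n)
                end) R' ->
    cut_step R R'
| step_bang (R R' B' : prestruct) (c n m : node R) (aux s1 s2 : seq (arc R))
    (x y : arc R) (t1 t2 : seq (arc (box m))) (d : arc (box m)) :
    lab c = Cut -> lab n = Bang -> lab m = Bang -> m != n ->
    order n = rcons aux x -> ahead x = c ->
    (* y is an auxiliary port of m and d the corresponding box conclusion *)
    order m = s1 ++ y :: s2 -> 0 < size s2 -> ahead y = c ->
    concls (box m) = t1 ++ d :: t2 -> size t1 = size s1 ->
    @keeping (enter_box_graph n aux t1 d t2)
      (fun v => match v with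
                | inl u => u != ahead d
                | inr (Some (Some a)) => a \in aux
                | _ => true
                end)
      (fun e => match e with
                | inl _ => true
                | inr a => a \in order n
                end) B' ->
    @keeping (enter_graph m aux s1 s2 B')
      (fun v => v \notin [:: c; n]) (fun e => e \notin [:: x; y]) R' ->
    cut_step R R'
| step_box (R R' B' : prestruct) (n : node R) :
    lab n = Bang -> cut_step (box n) B' ->
    iso R' (@PreStruct R (fun v => if v == n then B' else box v)) ->
    cut_step R R'.

(* Main.v *)
(** Call a labelling of the arcs by booleans a coboundary if it is
    f (tail a) + f (head a) (mod 2) for some potential f on the nodes. A graph is
    acyclic iff every labelling is a coboundary, and then
    nodes = components + arcs. In a switching graph of a ground-structure,
    nodes - arcs - weakenings is a sum of contributions of the nodes depending
    only on their labels: +1 for ax, 1 and !, -1 for cut and tensor, 0 otherwise.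
    Hence ACCw says that all switching graphs have all potentials and that the
    labels are balanced, and both parts can be followed through each step:
    the potential of a labelling of the reduct is written down explicitly from
    potentials of the redex. When several switchings of the redex are needed at
    once (tensor/par, !/?), a potential given by one of them is corrected by the
    conjunction of the locally constant functions given by each of them. *)
Require Import Defs.
From mathcomp Require Import all_boot zify.
Import Defs.

Set Implicit Arguments.
Unset Strict Implicit.
Unset Printing Implicit Defensive.

(** * Potentials, acyclicity and the number of components *)

(** This is the vanishing of the first cohomology, over the two-element field, of the subgraph with
    arc set [S]. *)
Definition has_potentials (G : graph) (S : pred (arc G)) : Prop :=
  forall g : arc G -> bool, exists f : node G -> bool,
    forall a, S a -> f (atail a) (+) f (ahead a) = g a.

Section Potentials.
Variable G : graph.
Implicit Types (a : arc G) (x y : node G) (s : seq (arc G)).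

Lemma endsC a x y : ends a x y = ends a y x.
Proof. by rewrite /ends orbC. Qed.

Lemma potential_ends (f : node G -> bool) a x y :
  ends a x y -> f (atail a) (+) f (ahead a) = f x (+) f y.
Proof. by case/orP=> /andP[/eqP-> /eqP->] //; rewrite addbC. Qed.

(** Take the indicator of the first arc of a cycle as labelling: its potential changes across that
    arc, yet is constant along the rest of the cycle, where the arc does not occur again. *)
Lemma potentials_acyclic : has_potentials (G := G) predT -> acyclic G.
Proof.
move=> exG x [|[a y] p] [[wp inj_p ne_p] // _ last_p].
have [f fE] := exG (pred1 a).
have telescope q z : walk z q -> a \notin unzip1 q -> f (last z (unzip2 q)) = f z.
  elim: q z => [|[b t] q IHq] //= z /andP[zbt wq].
  rewrite inE negb_or => /andP[neq_ab /(IHq _ wq) ->].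
  have := potential_ends f zbt; rewrite fE //= eq_sym (negPf neq_ab).
  by case: (f z) (f t) => -[].
move: wp => /= /andP[xay wp].
have first_a : f x (+) f y by rewrite -(potential_ends f xay) fE /=.
suffices a_once : a \notin unzip1 p.
  by move: first_a; rewrite -(telescope p y wp a_once) -[in f x]last_p /= addbb.
apply/negP=> /(nthP a)[i]; rewrite size_map => lt_i Ei.
have walk_nth q z : walk z q -> forall j, j < size q ->
    ends (nth a (unzip1 q) j) (nth x (z :: unzip2 q) j)
      (nth x (unzip2 q) j).
  elim: q z => [|[b t] q IHq] //= z /andP[zbt wq] [|j] //=.
  by rewrite ltnS => /(IHq _ wq).
have := walk_nth p y wp i lt_i; rewrite Ei => ends_i.
(* A second occurrence as the last arc of the cycle is excluded by the third clause of [is_path]. *)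
have [eq_i | neq_i] := eqVneq i.+1 (size p).
  have gt0p : 0 < size p by rewrite -eq_i.
  apply: (ne_p _ a) => //=.
  by rewrite -Ei (last_nth a) /= size_map -eq_i.
have lt_i1 : i.+1 < size p by rewrite ltn_neqAle neq_i.
(* The ends of an inner arc of the cycle are inner nodes, hence are not x. *)
have not_x j : j < size p -> nth x (y :: unzip2 p) j <> x.
  move=> lt_j Ej; have [] // := inj_p 0 j.+1; rewrite //= ?ltnS 1?ltnW //.
  by move=> /= _ /eqP; rewrite eqSS ltn_eqF.
have n1 := not_x i lt_i; have n2 := not_x i.+1 lt_i1.
case/orP: xay => /andP[/eqP Et /eqP Eh]; case/orP: ends_i => /andP[/eqP E1 /eqP E2];
  try by case: n1; rewrite -E1 ?Et ?Eh.
- by case: n2; rewrite /= -E1 Et.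
- by case: n2; rewrite /= -E2 Eh.
- by case: n1; rewrite -E2 Eh.
Qed.

Definition adj (s : seq (arc G)) : rel (node G) :=
  fun x y => has (fun a => ends a x y) s.

Lemma connect_adj_sym s : connect_sym (adj s).
Proof.
by apply: sym_connect_sym => x y; apply: eq_has => a; rewrite endsC.
Qed.

Lemma adj_path s x p : path (adj s) x p ->
  exists q, [/\ walk x q, unzip2 q = p & {subset unzip1 q <= s}].
Proof.
elim: p x => [|y p IHp] x /=; first by exists [::].
case/andP=> /hasP[a sa xay] /IHp[q [wq <- sub_q]].
exists ((a, y) :: q); split; rewrite /= ?xay // => b.
by rewrite inE => /predU1P[-> | /sub_q].
Qed.

(** A connecting path, once shortened to a simple one, would close into a cycle through [a]. *)
Lemma acyclic_bridge a s : acyclic G -> a \notin s ->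
  ~~ connect (adj s) (ahead a) (atail a).
Proof.
move=> acG; apply: contra => /connectP[p path_p last_p].
case/shortenP: path_p last_p => p' /adj_path[q [wq <- sub_q]] uniq_q _ last_q.
case: (boolP (a \in s)) => // /negP nsa; case: (acG (atail a) ((a, ahead a) :: q)).
split=> //; split => [||/= lt0q a0].
- by rewrite /= /ends !eqxx.
- move=> i j /= /andP[lt_ij le_j]; case: j => // j in lt_ij le_j *.
  rewrite ltnS in le_j; have lt_j : j < (size (unzip2 q)).+1 by rewrite size_map ltnS.
  case: i => [|i] in lt_ij * => /= Eij.
    split=> //; move: Eij; rewrite {1}last_q (last_nth (atail a)) => /eqP.
    by rewrite nth_uniq //= size_map => /eqP <-.
  have lt_i : i < (size (unzip2 q)).+1 by apply: ltn_trans lt_j.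
  by move/eqP: Eij; rewrite nth_uniq // ltn_eqF.
- move=> E; apply: nsa; apply: sub_q; rewrite E.
  by case: (q) lt0q => //= b q' _; apply: mem_last.
Qed.

Lemma acyclic_potentials : acyclic G -> has_potentials (G := G) predT.
Proof.
move=> acG g; suffices [f fE] : exists f : node G -> bool,
    {in enum (arc G), forall a, f (atail a) (+) f (ahead a) = g a}.
  by exists f => a _; apply: fE; rewrite mem_enum.
elim: (enum _) (enum_uniq (arc G)) => [|a s IHs] /=; first by exists xpred0.
case/andP=> nsa /IHs[f fE].
have [Ea | neq_a] := eqVneq (f (atail a) (+) f (ahead a)) (g a).
  by exists f => b; rewrite inE => /predU1P[-> | /fE].
(* Flip [f] on the component of the head of [a] for the arcs of [s]. No arc of [s] is affected, and
   the tail of [a] lies outside by [acyclic_bridge]. *)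
exists (fun v => f v (+) connect (adj s) (ahead a) v) => b.
rewrite addbACA inE => /predU1P[-> | sb].
  rewrite connect0 (negPf (acyclic_bridge acG nsa)).
  by move: neq_a; case: (_ (+) f _) (g a) => -[].
have ->: connect (adj s) (ahead a) (atail b) = connect (adj s) (ahead a) (ahead b).
  apply: same_connect_r; first exact: connect_adj_sym.
  by apply: connect1; apply/hasP; exists b; rewrite // /ends !eqxx.
by rewrite addbb addbF fE.
Qed.

Lemma adjacent_sym : connect_sym (@adjacent G).
Proof.
by apply: sym_connect_sym => x y; apply: eq_existsb => a; rewrite endsC.
Qed.

Lemma adjacent_equiv :
  {in [set: node G] & &, equivalence_rel (connect (@adjacent G))}.
Proof.
move=> x y z _ _ _; split=> [|xy]; first exact: connect0.
exact: (same_connect adjacent_sym xy).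
Qed.

(* Every node function is uniquely the sum of a chosen potential of its
   coboundary and of a function constant on components: 2^nodes = 2^arcs * 2^cc. *)
Lemma potentials_card : has_potentials (G := G) predT ->
  #|node G| = #|arc G| + #|cc G|.
Proof.
move=> exG.
have /fin_all_exists[pot potE] (g : {ffun arc G -> bool}) :
    exists f : {ffun node G -> bool},
      forall a, f (atail a) (+) f (ahead a) = g a.
  by have [f fE] := exG g; exists (finfun f) => a; rewrite !ffunE fE.
pose cls x := pblock (cc G) x.
have ccP := equivalence_partitionP adjacent_equiv.
have cls_cc x : cls x \in cc G.
  by apply: pblock_mem; rewrite (cover_partition ccP).
have cls_eq x y : (cls x == cls y) = connect (@adjacent G) x y.
  rewrite eq_pblock ?(cover_partition ccP) //; last by case/and3P: ccP.
  by rewrite pblock_equivalence_partition // ; apply: adjacent_equiv.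
have cls_arc a : cls (atail a) = cls (ahead a).
  apply/eqP; rewrite cls_eq; apply: connect1; apply/existsP; exists a.
  by rewrite /ends !eqxx.
pose sum (u : {ffun arc G -> bool} * {set {set node G}}) : {ffun node G -> bool} :=
  [ffun v => pot u.1 v (+) (cls v \in u.2)].
pose D := setX [set: {ffun arc G -> bool}] (powerset (cc G)).
have sum_inj : {in D &, injective sum}.
  move=> [g K] [h L]; rewrite !inE /= => sKc sLc eq_s.
  (* Membership of [cls] in a fixed set has zero coboundary, so the coboundary of the sum recovers
     the labelling. *)
  have eq_gh : g = h.
    apply/ffunP=> a; rewrite -!potE.
    have := congr1 (fun f : {ffun _ -> _} => f (atail a) (+) f (ahead a)) eq_s.
    by rewrite !ffunE /= cls_arc !(addbACA _ (_ \in _)) !addbb !addbF.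
  rewrite eq_gh in eq_s *; congr (_, _); apply/setP=> X.
  have [Xcc | nXcc] := boolP (X \in cc G); last first.
    by rewrite (contraNF (subsetP sKc X)) // (contraNF (subsetP sLc X)).
  have /set0Pn[x Xx] : X != set0.
    by apply: contraTneq Xcc => ->; case/and3P: ccP.
  have clsx : cls x = X by apply: def_pblock => //; case/and3P: ccP.
  have /ffunP/(_ x) := eq_s; rewrite !ffunE /= clsx.
  exact: addbI.
have sum_onto : sum @: D = [set: {ffun node G -> bool}].
  apply/setP=> f; rewrite [RHS]inE; apply/imsetP.
  pose g := [ffun a => f (atail a) (+) f (ahead a)].
  pose k v := f v (+) pot g v.
  have k_arc a : k (atail a) = k (ahead a).
    have := potE g a; rewrite /k ffunE.
    by case: (f _) (f _) (pot g _) (pot g _) => -[] [] [].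
  have k_cls x y : cls x = cls y -> k x = k y.
    move/eqP; rewrite cls_eq => /connectP[p].
    elim: p x => [|z p IHp] x /=; first by move=> _ ->.
    case/andP=> /existsP[a xaz] /IHp /[apply] <-.
    by case/orP: xaz => /andP[/eqP <- /eqP <-].
  exists (g, [set cls x | x in [set x | k x]]).
    by rewrite !inE; apply/subsetP=> _ /imsetP[x _ ->].
  apply/ffunP=> v; rewrite ffunE /=.
  have ->: (cls v \in [set cls x | x in [set x | k x]]) = k v.
    apply/imsetP/idP=> [[x] | kv]; last by exists v; rewrite ?inE.
    by rewrite inE => kx /k_cls ->.
  by rewrite /k addbC -addbA addbb addbF.
have := card_in_imset sum_inj; rewrite sum_onto cardsX card_powerset !cardsT.
by rewrite !card_ffun card_bool -expnD => /eqP; rewrite eqn_exp2l // => /eqP.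
Qed.

End Potentials.

(** * Soundness and balance as a form of the correctness criterion *)

Definition positive (l : label) : bool := l \in [:: Ax; One; Bang].
Definition negative (l : label) : bool := l \in [:: Cut; Tens].

Definition balanced (G : preground) : Prop :=
  #|[pred v : node G | positive (lab v)]|
    = #|[pred v : node G | negative (lab v)]| + 1.

(** The number of premises is not tested: a [?] node with at most one premise satisfies the
    condition trivially. A thin set may also avoid all premises of a node. *)
Definition thin (G : preground) (S : pred (arc G)) : Prop :=
  forall a b, S a -> S b -> ahead a = ahead b ->
    lab (ahead a) \in [:: Par; Why] -> a = b.

(* The thin sets are the subsets of the arc sets of switching graphs; having
   potentials is inherited by subsets. *)
Definition sound (G : preground) (K : pred (arc G)) : Prop :=
  forall S : pred (arc G), subpred S K -> thin S -> has_potentials S.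

(** This is the invariant carried through the steps. On proof-structures it amounts to [ACCw], by
    [proof_structure_ACCw]. *)
Inductive good (R : prestruct) : Prop :=
  Good of sound (G := R) predT & balanced R &
    (forall n : node R, lab n = Bang -> good (box n)).

Section Soundness.
Variable G : preground.
Implicit Types (phi : node G -> arc G) (S : pred (arc G)).

(** Count each arc at its head. The identity then holds node by node: a switched node receives one
    arc, any other node all its premises, and the arities give the rest. *)
Lemma card_switching_graph phi : ground_structure G -> is_switching phi ->
  #|node G| + #|[pred v : node G | negative (lab v)]|
    = #|arc (switching_graph phi)| + #|w_nodes G|
      + #|[pred v : node G | positive (lab v)]|.
Proof.
case=> ar _ _ _ swphi.
rewrite card_sig -!sum1_card [X in X + _ + _](partition_big (@ahead G) predT) //=.
rewrite [X in _ + X]big_mkcond [X in _ + X + _]big_mkcond /= [X in _ = _ + X]big_mkcond.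
rewrite -!big_split /=; apply: eq_bigr => v _.
have ->: \sum_(a : arc G | (switched (ahead a) ==> (phi (ahead a) == a))
                              && (ahead a == v)) 1
    = if switched v then 1 else #|premises v|.
  case: ifPn => sv.
    rewrite (big_pred1 (phi v)) // => a /=.
    apply/andP/eqP => [[/implyP H /eqP Ea]|->].
      by rewrite -Ea; apply/esym/eqP/H; rewrite Ea.
    by move: (swphi v sv); rewrite inE => /eqP E; rewrite E !eqxx implybT.
  rewrite -sum1_card; apply: eq_bigl => a; rewrite inE.
  by case: (ahead a =P v) => [->|]; rewrite ?andbF // (negPf sv).
have := ar v; rewrite /arity_ok /switched inE /positive /negative !inE.
by case: (lab v) => //=; do ?[case/andP]; do ?[move/eqP->] => //;
  case: #|premises v| => [|[|k]].
Qed.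

Lemma switching_graph_acyclic phi : sound (G := G) predT ->
  acyclic (switching_graph phi).
Proof.
move=> sG; apply: potentials_acyclic => g.
pose S a := switched (ahead a) ==> (phi (ahead a) == a).
have thS : thin S.
  move=> a b Sa Sb Eab lab_a; have [sa|] := boolP (switched (ahead a)).
    by move: Sa Sb; rewrite /S -Eab sa => /eqP Sa /eqP Sb; rewrite -Sa -Sb.
  (* What remains is a [?] node with at most one premise. *)
  rewrite /switched; case: (lab _) lab_a => //= _; rewrite -leqNgt => le1.
  by apply: (card_le1_eqP le1); rewrite inE ?Eab.
have [f fE] := sG S (fun _ _ => isT) thS
  (fun a => if insub a is Some u then g u else false).
by exists f => -[a Sa] _; rewrite /= fE // insubT.
Qed.

Lemma switching_extends S : ground_structure G -> thin S ->
  exists2 phi, is_switching phi &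
    forall a, S a -> switched (ahead a) -> phi (ahead a) = a.
Proof.
case=> ar _ _ _ thS.
have /fin_all_exists[phi phiE] (v : node G) : exists b : arc G, switched v ->
    b \in premises v /\ forall a, S a -> ahead a = v -> b = a.
  have [p0 | /set0Pn[b pb]] := eqVneq (premises v) set0.
    (* The value of [phi] at a node without premises is irrelevant, but some arc must exist: by its
       arity, such a node has a conclusion. *)
    have ns : switched v = false.
      by have := ar v; rewrite /switched /arity_ok p0 cards0; case: (lab v).
    have [c0 | /set0Pn[b _]] := eqVneq (conclusions v) set0.
      have := ar v; rewrite /arity_ok p0 c0 cards0.
      by case: (lab v).
    by exists b; rewrite ns.
  have [/existsP[a /andP[Sa /eqP Ea]] | none] :=
      boolP [exists a, S a && (ahead a == v)].
    exists a => sv; rewrite inE Ea; split=> // a1 Sa1 Ea1.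
    apply: thS; rewrite ?Ea1 // Ea.
    by move: sv; rewrite /switched; case: (lab v).
  exists b => _; split=> // a Sa Ea.
  by case/existsP: none; exists a; rewrite Sa Ea eqxx.
exists phi => [v sv | a Sa sa]; first by case: (phiE v sv).
by case: (phiE _ sa) => _; apply.
Qed.

(** Acyclicity of all switching graphs is soundness, since each thin set extends to a switching.
    Given acyclicity, components are nodes minus arcs, and [card_switching_graph] turns their number
    into balance. *)
Lemma ground_ACCwP : ground_structure G ->
  ground_ACCw G <-> sound (G := G) predT /\ balanced G.
Proof.
move=> gsG; have thin0 : thin (G := G) pred0 by [].
split=> [acc | [sG bal] phi swphi].
  split=> [S _ thS g |].
    have [phi swphi phiE] := switching_extends gsG thS.
    have [/acyclic_potentials pot _] := acc phi swphi.
    have [f fE] := pot (fun u => g (val u)).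
    exists f => a Sa.
    have Pa : switched (ahead a) ==> (phi (ahead a) == a).
      by apply/implyP=> sa; rewrite phiE.
    exact: (fE (exist _ a Pa)).
  (* Extending the empty set shows that a switching exists; one suffices because [balanced] does not
     mention [phi]. *)
  have [phi swphi _] := switching_extends gsG thin0.
  have [acy ccE] := acc phi swphi.
  have := card_switching_graph gsG swphi.
  rewrite (potentials_card (acyclic_potentials acy)) ccE /balanced.
  by move=> E; lia.
have acy : acyclic (switching_graph phi) := switching_graph_acyclic sG.
split=> //.
have := card_switching_graph gsG swphi.
rewrite (potentials_card (acyclic_potentials acy)) bal.
by move=> E; lia.
Qed.

End Soundness.

(** * Transfer along renaming and erasing *)

Lemma renaming_sound (G' G : preground) (KN : pred (node G)) (KA : pred (arc G))
    (fn : node G' -> node G) (fa : arc G' -> arc G) :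
  renaming KN KA fn fa -> sound KA -> sound (G := G') predT.
Proof.
case=> fnI faI _ faP ft fh fl _ _ sG S _ thS g.
(* [img] pushes forward both the set [S] and the labelling [g]. *)
pose img (h : arc G' -> bool) a := [exists a' : arc G', (fa a' == a) && h a'].
have imgE h a' : img h (fa a') = h a'.
  apply/existsP/idP=> [[b /andP[/eqP/faI->]] // | ha].
  by exists a'; rewrite eqxx.
have subS : subpred (img S) KA.
  by move=> a /existsP[a' /andP[/eqP<- _]]; rewrite -faP codom_f.
have thS' : thin (img S).
  move=> _ _ /existsP[a /andP[/eqP<- Sa]] /existsP[b /andP[/eqP<- Sb]].
  by rewrite -!fh fl => /fnI Eab lab_a; congr fa; apply: thS.
have [f fE] := sG _ subS thS' (img g).
by exists (f \o fn) => a Sa; rewrite /= ft fh fE imgE.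
Qed.

Lemma renaming_card (G' G : preground) (KN : pred (node G)) (KA : pred (arc G))
    (fn : node G' -> node G) (fa : arc G' -> arc G) (Q : pred label) :
  renaming KN KA fn fa ->
  #|[pred v : node G' | Q (lab v)]| = #|[pred v : node G | KN v && Q (lab v)]|.
Proof.
case=> fnI _ fnP _ _ _ fl _ _.
rewrite -(card_image fnI); apply: eq_card => v; rewrite inE -fnP.
apply/imageP/andP => [[v' Qv ->] | [/codomP[v' ->]]].
  by rewrite codom_f fl.
by rewrite fl => Qv; exists v'.
Qed.

Lemma iso_good R' R : iso R' R -> good R -> good R'.
Proof.
elim: R' R => [G' b' IH] [G b] /= [fn [fa [ren isob]]] [sG bal gb].
have noK Q : #|[pred v : node G' | Q (lab v)]| = #|[pred v : node G | Q (lab v)]|.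
  by rewrite (renaming_card _ ren).
split=> /= [||n lab_n]; first exact: renaming_sound ren sG.
  by rewrite /balanced !noK.
by apply: IH (isob n lab_n) _; apply: gb; rewrite (renaming_lab ren).
Qed.

(** The elementary steps all conclude through this lemma. The auxiliary graph [P] still contains the
    erased nodes and arcs, so it is not expected to be good itself. *)
Lemma keeping_good (P : prestruct) (KN : pred (node P)) (KA : pred (arc P))
    (R' : prestruct) :
  keeping KN KA R' -> sound KA ->
  #|[pred v : node P | KN v && positive (lab v)]|
    = #|[pred v : node P | KN v && negative (lab v)]| + 1 ->
  (forall n : node P, KN n -> lab n = Bang -> good (box n)) ->
  good R'.
Proof.
case=> fn [fa [ren isob]] sP bal gb.
split=> [||n lab_n]; first exact: renaming_sound ren sP.
  by rewrite /balanced !(renaming_card _ ren).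
apply: iso_good (isob n lab_n) _; apply: gb; last by rewrite (renaming_lab ren).
by rewrite -(renaming_node ren) codom_f.
Qed.

Lemma proof_structure_ACCw R : proof_structure R -> ACCw R <-> good R.
Proof.
elim: R => G b IH [gsG psb]; split=> [[accG accb] | [sG bal gb]].
  have [sG bal] := (ground_ACCwP gsG).1 accG.
  apply: Good => [|| n lab_n]; [exact: sG | exact: bal |].
  have [psn _] := psb n lab_n; apply: (proj1 (IH n psn)).
  by apply: accb; exists n.
apply: ACCwIntro => [|_ [n lab_n ->]]; first by apply/(ground_ACCwP gsG).
have [psn _] := psb n lab_n; apply: (proj2 (IH n psn)).
exact: gb.
Qed.

Lemma card_erase (T : finType) (s : seq T) (Q : pred T) : uniq s ->
  #|[pred v | Q v]| = count Q s + #|[pred v | (v \notin s) && Q v]|.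
Proof.
move=> us; rewrite -(cardID (mem s) [pred v | Q v]) -size_filter; congr (_ + _).
rewrite -(card_uniqP (filter_uniq Q us)); apply: eq_card => v.
by rewrite !inE mem_filter.
Qed.

Lemma card_sum_pred (A B : finType) (Q : pred (A + B)) :
  #|[pred u | Q u]| = #|[pred a | Q (inl a)]| + #|[pred b | Q (inr b)]|.
Proof. by rewrite -!sum1_card big_sumType. Qed.

(** * Soundness through each step *)

Section Erasing.
Variable R : prestruct.
Hypothesis sR : sound (G := R) predT.

(** Adding a constant to a potential does not change its coboundary, which allows normalising it at
    [r]. *)
Lemma sound_potential (S : pred (arc R)) (g : arc R -> bool) (r : node R) :
  thin S -> exists2 f : node R -> bool, f r = false &
    forall a, S a -> f (atail a) (+) f (ahead a) = g a.
Proof.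
move=> thS; have [f fE] := sR (fun _ _ => isT) thS g.
exists (fun v => f v (+) f r) => [|a Sa]; first exact: addbb.
by rewrite addbACA addbb addbF fE.
Qed.

(** This serves to put back the erased premises of the cut. *)
Lemma thin_setU (S : pred (arc R)) (s : seq (arc R)) :
  thin S -> {in s, forall a, lab (ahead a) \notin [:: Par; Why]} ->
  thin [pred a | S a || (a \in s)].
Proof.
move=> thS ns a b /orP[Sa | /ns /negPf-> //] /orP[Sb | /ns].
  exact: thS.
by move=> + -> => /negPf->.
Qed.

(** Labelling [a0] and [b] by 0 forces [f] to agree at [m], [c] and the tail of [b], so moving the
    tail of [a] is harmless. *)
Lemma ax_sound (a a0 b : arc R) (c m : node R) :
  lab c = Cut -> ahead a0 = c -> ahead b = c -> atail a0 = m -> atail a = m ->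
  sound (G := ax_graph a b) [pred e | e \notin [:: a0; b]].
Proof.
move=> labc ha0 hb ta0 ta S subS thS g.
pose S1 := [pred e | S e || (e \in [:: a0; b])].
have thS1 : thin (G := R) S1.
  apply: thin_setU => // e.
  by rewrite !inE => /orP[] /eqP->; rewrite ?ha0 ?hb labc.
have [f _ fE] := sound_potential (fun e => (e \notin [:: a0; b]) && g e) m thS1.
exists f => e Se; have ne : e \notin [:: a0; b] := subS e Se.
have := fE e; rewrite /= Se ne /= => /(_ isT) <-.
case: eqP => [->|//]; have := fE a0; have := fE b.
rewrite /= !inE !eqxx !orbT ta ta0 ha0 hb => /(_ isT) + /(_ isT).
by case: (f m) (f c) (f (atail b)) => -[] [].
Qed.

(** A switching of the redex keeps one premise of the par, while the reduct may use both. A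
    potential for the choice of [pl] fits the left cut and misses the right one by [eps]. The
    correction must be [eps] at the tail of [tr] and 0 at the tails of [tl], [pl] and [pr]; it is
    the conjunction of two functions, one per choice. *)
Lemma tens_sound (c t p : node R) (x y tl tr pl pr : arc R) :
  ground_structure R -> lab c = Cut -> lab t = Tens -> lab p = Par ->
  ahead x = c -> ahead y = c -> atail x = t -> atail y = p ->
  order t = [:: tl; tr] -> order p = [:: pl; pr] ->
  sound (G := tens_graph tl tr pl pr) [pred e | e \notin [:: x; y]].
Proof.
move=> [_ _ _ ord] labc labt labp hx hy tx ty ot op S subS thS g.
have [ut ht] : uniq [:: tl; tr] /\ [:: tl; tr] =i premises t.
  by rewrite -ot; apply: ord; rewrite labt.
have hp : [:: pl; pr] =i premises p.
  by rewrite -op; case: (ord p); rewrite ?labp.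
have prem_eq e (u v : arc R) n : [:: u; v] =i premises n ->
    (e \in [:: u; v]) = (ahead e == n).
  by move=> ->; rewrite inE.
have htl : ahead tl = t by apply/eqP; rewrite -(prem_eq _ _ _ _ ht) !inE eqxx.
have htr : ahead tr = t by apply/eqP; rewrite -(prem_eq _ _ _ _ ht) !inE eqxx orbT.
have hpl : ahead pl = p by apply/eqP; rewrite -(prem_eq _ _ _ _ hp) !inE eqxx.
have hpr : ahead pr = p by apply/eqP; rewrite -(prem_eq _ _ _ _ hp) !inE eqxx orbT.
have neq_tl_tr : tl != tr by case/andP: ut; rewrite inE.
have neq_tp : t != p by apply: contra_eq_neq labt => ->; rewrite labp.
have neq_ct : c != t by apply: contra_eq_neq labt => <-; rewrite labc.
have neq_cp : c != p by apply: contra_eq_neq labp => <-; rewrite labc.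
have head_neq (u v : arc R) : ahead u != ahead v -> u == v = false.
  by apply: contraNF => /eqP->.
pose S0 (e : arc R) := S e && (e \notin [:: tl; tr; pl; pr]).
(* The traces in [R] of [S], with the par switched to [q]. *)
pose Sw (q e : arc R) := S0 e || (e \in [:: x; y; tl; tr; q]).
have thSw q : q \in [:: pl; pr] -> thin (G := R) (Sw q).
  move=> q_in; have hq : ahead q = p by apply/eqP; rewrite -(prem_eq _ _ _ _ hp).
  have S0p e : S0 e -> ahead e != p.
    by case/andP=> _; rewrite -(prem_eq _ _ _ _ hp) !inE !negb_or => /and4P[_ _ -> ->].
  have S0E e : S0 e -> S e /\ @ahead (tens_graph tl tr pl pr) e = inl (ahead e).
    case/andP=> Se; rewrite !inE !negb_or.
    move=> /and4P[/negPf n1 /negPf n2 /negPf n3 /negPf n4].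
    by split; rewrite //= !inE n1 n2 n3 n4.
  have notq e : e \in [:: x; y; tl; tr; q] -> lab (ahead e) \in [:: Par; Why] -> e = q.
    by rewrite !inE => /or4P[|||/orP[]] /eqP-> //;
      rewrite ?hx ?hy ?htl ?htr ?labc ?labt.
  move=> e e' /orP[Se|/notq eq] /orP[Se'|/notq eq'] Eh lab_e.
  - have [[Se1 he] [Se1' he']] := (S0E _ Se, S0E _ Se').
    apply: (thS e e' Se1 Se1'); first by rewrite he he' Eh.
    by rewrite he.
  - by have := S0p e Se; rewrite Eh eq' ?hq ?eqxx // -Eh.
  - by have := S0p e' Se'; rewrite -Eh eq ?hq ?eqxx.
  - by rewrite eq // eq' // -Eh.
have [f f0 fE] := sound_potential (fun e => (e \notin [:: x; y]) && g e) t
  (thSw pl (mem_head _ _)).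
pose eps := f (atail pr) (+) f (atail tr) (+) g tr (+) g pr.
(* Such a [k] vanishes at [t], hence at [c] and [p] through [x] and [y], hence at the tail of
   [q]. *)
have corr q : q \in [:: pl; pr] -> exists k : node R -> bool,
    [/\ forall e, S0 e -> k (atail e) = k (ahead e), k (atail tl) = false,
        k (atail tr) = eps & k (atail q) = false].
  move=> q_in; have [k k0 kE] :=
    sound_potential (fun e => (e == tr) && eps) t (thSw q q_in).
  have hq : ahead q = p by apply/eqP; rewrite -(prem_eq _ _ _ _ hp).
  exists k; split.
  - move=> e S0e; have := kE e; rewrite /Sw S0e => /(_ isT).
    case/andP: S0e => _; rewrite !inE !negb_or => /and4P[_ /negPf-> _ _].
    by case: (k _) (k _) => -[].
  - have := kE tl; rewrite /Sw !inE eqxx !orbT (negPf neq_tl_tr) htl k0 addbF.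
    exact.
  - by have := kE tr; rewrite /Sw !inE eqxx !orbT htr k0 addbF => /(_ isT).
  - have := kE x; have := kE y; have := kE q.
    rewrite /Sw !inE !eqxx !orbT hq hx hy tx ty k0.
    rewrite !(head_neq _ tr) ?hq ?hx ?hy ?htr 1?[p == t]eq_sym //.
    move=> /(_ isT) + /(_ isT) + /(_ isT) /=.
    by case: (k _) (k p) (k c) => -[] [].
have [k1 [k1E k1tl k1tr k1q]] := corr pl (mem_head _ _).
have pr_in : pr \in [:: pl; pr] by rewrite !inE eqxx orbT.
have [k2 [k2E k2tl k2tr k2q]] := corr pr pr_in.
(* The conjunction stays constant along [S0]; [k1] makes it vanish at the tail of [pl], and [k2] at
   that of [pr]. *)
pose h v := f v (+) (k1 v && k2 v).
have fp : f p = false.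
  have := fE x; have := fE y; rewrite /Sw !inE !eqxx !orbT hx hy tx ty f0 /=.
  by move=> /(_ isT) + /(_ isT); case: (f p) (f c) => -[].
have notc q : ahead q != c -> q \notin [:: x; y].
  by apply: contra; rewrite !inE => /orP[] /eqP ->; rewrite ?hx ?hy.
have ftl : f (atail tl) = g tl.
  have := fE tl; rewrite notc ?htl 1?eq_sym // f0 addbF; apply.
  by rewrite /Sw !inE eqxx !orbT.
have ftr : f (atail tr) = g tr.
  have := fE tr; rewrite notc ?htr 1?eq_sym // f0 addbF; apply.
  by rewrite /Sw !inE eqxx !orbT.
have fpl : f (atail pl) = g pl.
  have := fE pl; rewrite notc ?hpl 1?eq_sym // fp addbF; apply.
  by rewrite /Sw !inE eqxx !orbT.
exists (fun v => match v with
  | inl v => h v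
  | inr true => h (atail tl) (+) g tl
  | inr false => h (atail tr) (+) g tr end) => e Se /=.
rewrite !inE; have [->|ntl] /= := eqVneq e tl; first by rewrite addbA addbb.
have [->|npl] /= := eqVneq e pl.
  by rewrite /h k1tl k1q ftl fpl !addbF addbb addbF.
have [->|ntr] /= := eqVneq e tr; first by rewrite addbA addbb.
have [->|npr] /= := eqVneq e pr.
  rewrite /h k2q k1tr k2tr andbb andbF ftr /eps ftr.
  by case: (f _) (g tr) (g pr) => -[] [].
have S0e : S0 e by rewrite /S0 (Se : S e) !inE (negPf ntl) (negPf ntr) (negPf npl).
have ne : e \notin [:: x; y] := subS e Se.
have := fE e; rewrite ne /Sw S0e /h k1E // k2E //= => /(_ isT) <-.
by rewrite addbACA addbb addbF.
Qed.


(** Potentials of the box and of [R] are glued, seeing the box from [R] as contracted to the node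
    [n]. Labelling [y] by 0 makes [f] agree at [d] and [c], so redirecting [z] is harmless. *)
Lemma open_sound (c n d : node R) (y z : arc R) :
  ground_structure R -> ground_structure (box n) -> sound (G := box n) predT ->
  size (concls (box n)) = size (order n) ->
  lab c = Cut -> lab n = Bang -> lab d = Der ->
  atail y = d -> ahead y = c -> ahead z = d ->
  sound (G := open_graph c n z)
    [pred e | match e with inl e => e \notin y :: order n | inr _ => true end].
Proof.
move=> [_ _ ordn _] [_ [uc cE] _ _] sB size_eq labc labn labd ty hy hz S subS thS g.
have [uo oE] := ordn n labn.
have tailn e : (e \in order n) = (atail e == n) by rewrite oE inE.
(* As the box has as many conclusions as [n], the default value of [nth] is reached exactly outside
   the ports of [n]. *)
pose sub (e : arc R) : arc R + arc (box n) :=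
  nth (inl e) [seq inr b | b <- concls (box n)] (index e (order n)).
have sub_out e : e \notin order n -> sub e = inl e.
  by rewrite -index_mem -leqNgt => le_e; rewrite /sub nth_default // size_map size_eq.
have sub_in e : e \in order n -> exists b, [/\ sub e = inr b, b \in concls (box n)
    & nth z (order n) (index b (concls (box n))) = e].
  move=> oe; have lt_e : index e (order n) < size (concls (box n)).
    by rewrite size_eq index_mem.
  have [b0 _] : exists b0 : arc (box n), true.
    by case: (concls _) lt_e => // b; exists b.
  exists (nth b0 (concls (box n)) (index e (order n))).
  by rewrite /sub (nth_map b0) // mem_nth // index_uniq // nth_index.
have sub_port b : b \in concls (box n) -> exists e,
    [/\ e \in order n, sub e = inr b & nth z (order n) (index b (concls (box n))) = e].
  move=> cb; have lt_b : index b (concls (box n)) < size (order n).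
    by rewrite -size_eq index_mem.
  exists (nth z (order n) (index b (concls (box n)))); split=> //; first exact: mem_nth.
  by rewrite /sub index_uniq // (nth_map b) ?index_mem // nth_index.
have sub_inj : injective sub.
  move=> e e'; have [oe | /sub_out->] := boolP (e \in order n);
    have [oe' | /sub_out->] := boolP (e' \in order n).
  - have [[b [-> _ <-]] [b' [-> _ <-]]] := (sub_in e oe, sub_in e' oe').
    by case=> ->.
  - by have [b [->]] := sub_in e oe.
  - by have [b' [->]] := sub_in e' oe'.
  - by case.
pose head' (e : arc R) := if e == z then c else ahead e.
have head_sub e : @ahead (open_graph c n z) (sub e) = inl (head' e).
  have [oe | /sub_out->] := boolP (e \in order n); last by [].
  by have [b [-> cb be]] := sub_in e oe; rewrite /= cb be.
have thB : thin (G := box n) (fun b => S (inr b)).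
  move=> b b' Sb Sb' Eb lab_b.
  have nc : b \notin concls (box n) by rewrite cE; case: (lab _) lab_b.
  have nc' : b' \notin concls (box n) by rewrite cE -Eb; case: (lab _) lab_b.
  have := thS (inr b) (inr b') Sb Sb'; rewrite /= (negPf nc) (negPf nc') Eb.
  by rewrite -Eb => /(_ erefl lab_b) [].
have [fB fBE] := sB _ (fun _ _ => isT) thB (fun b => g (inr b)).
have ny : y \notin order n.
  by rewrite tailn ty; apply: contra_eq_neq labd => ->; rewrite labn.
have thR : thin (G := R) [pred e | S (sub e) || (e \in [:: y])].
  apply: thin_setU => [e e' Se Se' Ee lab_e |]; last first.
    by move=> e; rewrite inE => /eqP->; rewrite hy labc.
  have nz u : ahead u = ahead e -> head' u = ahead u.
    rewrite /head'; case: eqP => // -> Ez.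
    by move: lab_e; rewrite -Ez hz labd.
  apply: sub_inj; apply: thS => //; first by rewrite !head_sub (nz e) // (nz e') // Ee.
  by rewrite head_sub (nz e).
(* With [f] zero at [n], a port must absorb the value of [fB] at the tail of the matching box
   conclusion. *)
pose gR e := (e != y) && match sub e with
  | inl e => g (inl e) | inr b => g (inr b) (+) fB (atail b) end.
have [f fn fE] := sound_potential gR n thR.
have fdc : f d = f c.
  have := fE y; rewrite /gR /= inE eqxx orbT ty hy => /(_ isT).
  by case: (f d) (f c) => -[].
have fhead e : f (head' e) = f (ahead e).
  by rewrite /head'; case: eqP => // ->; rewrite hz.
exists (fun v => match v with inl v => f v | inr v => fB v end) => -[e | b] Se.
  have : e \notin y :: order n := subS _ Se.
  rewrite inE negb_or => /andP[ne oe] /=.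
  have := fE e; rewrite /gR /= sub_out // ne Se -/(head' e) fhead; exact.
rewrite /=; case: ifPn => [cb|ncb]; last exact: fBE.
have [e [oe se ->]] := sub_port b cb.
have te : atail e = n by apply/eqP; rewrite -tailn.
have ne : e != y by apply: contraNneq ny => <-.
have := fE e; rewrite /gR /= se ne Se -/(head' e) fhead te fn => /(_ isT) /= ->.
by rewrite addbC -addbA addbb addbF.
Qed.

(** Start from a potential [f] of [R]. Through the new cuts, the tail of each premise [p] of [q]
    dictates the value at the copy of [n] indexed by [p]. By thinness each new [?] node is joined to
    at most one copy, so the only obstruction is a defect [eps a] at each auxiliary port [a]. It is
    cancelled by a conjunction of functions, one for each premise that a switching may choose at
    [q]. *)
Lemma dup_sound (c n q : node R) (aux : seq (arc R)) (x y : arc R) :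
  ground_structure R ->
  lab c = Cut -> lab n = Bang -> lab q = Why ->
  order n = rcons aux x -> ahead x = c -> atail y = q -> ahead y = c ->
  sound (G := dup_graph n q aux)
    [pred e | match e with
              | inl a => a \notin [:: x; y]
              | inr (p, a) => (p \in premises q) && (a \in order n)
              end].
Proof.
move=> [_ _ ordn _] labc labn labq on hx ty hy S subS thS g.
have [uo oE] := ordn n labn.
have tailn e : (e \in rcons aux x) = (atail e == n) by rewrite -on oE inE.
have tx : atail x = n by apply/eqP; rewrite -tailn mem_rcons inE eqxx.
have taux e : e \in aux -> atail e = n.
  by move=> ae; apply/eqP; rewrite -tailn mem_rcons inE ae orbT.
have nxaux : x \notin aux by move: uo; rewrite on rcons_uniq => /andP[].
have neq_cq : c != q by apply: contra_eq_neq labq => <-; rewrite labc.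
(* [Sx] is the part of [S] that lives in [R] away from the premises of [q]; [Sp p] puts back [x],
   [y] and, if [p] enters [q], this single premise. *)
pose Sx e := (ahead e != q) && S (inl e).
pose Sp p e := (Sx e || (e \in [:: x; y])) || (e == p) && (ahead p == q).
have Sx_head e : Sx e -> @ahead (dup_graph n q aux) (inl e) = inl (ahead e).
  by case/andP=> /negPf /= ->.
have thSp p : thin (G := R) (Sp p).
  have thSx : thin (G := R) [pred e | Sx e || (e \in [:: x; y])].
    apply: thin_setU => [e e' Se Se' Ee lab_e |]; last first.
      by move=> e; rewrite !inE => /orP[] /eqP->; rewrite ?hx ?hy labc.
    have := thS (inl e) (inl e') (proj2 (andP Se)) (proj2 (andP Se')).
    by rewrite (Sx_head _ Se) (Sx_head _ Se') Ee -Ee => /(_ erefl lab_e) [].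
  have notq e : Sx e || (e \in [:: x; y]) -> ahead e != q.
    by case/orP=> [/andP[] // |]; rewrite !inE => /orP[] /eqP->; rewrite ?hx ?hy.
  move=> e e' /orP[Se|/andP[/eqP-> /eqP hp]]
    /orP[Se'|/andP[/eqP-> /eqP hp']] Ee lab_e //.
  - exact: thSx.
  - by have := notq e Se; rewrite Ee hp' eqxx.
  - by have := notq e' Se'; rewrite -Ee hp eqxx.
(* An auxiliary port of n above q would close a cycle through c. *)
have aux_q e : e \in aux -> ahead e != q.
  move=> ae; apply/eqP=> he.
  have [f _ fE] := sound_potential (fun a => a == e) n (thSp e).
  have neq_e u : ahead u = c -> u == e = false.
    by move=> hu; apply: contraNF neq_cq => /eqP Eu; rewrite -hu Eu he.
  have := fE x; have := fE y; have := fE e.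
  rewrite /Sp !inE !eqxx !orbT !neq_e // he eqxx orbT hx hy tx ty (taux e ae).
  by move=> /(_ isT) + /(_ isT) + /(_ isT); case: (f n) (f q) (f c) => -[] [].
(* Since [x] enters [c] and not [q], the set [Sp x] contains no premise of [q]. *)
have [f _ fE] := sound_potential (fun e => g (inl e)) n (thSp x).
pose via p (fp : bool) : bool := fp (+) g (inl p) (+) g (inr (p, x)).
(* For [a] in [aux], thinness at [WhyAt a] makes this [p] unique. *)
pose sel a := [pick p | S (inr (p, a))].
pose eps a := if sel a is Some p
  then f (ahead a) (+) g (inl a) (+) g (inr (p, a)) (+) via p (f (atail p)) else false.
have /fin_all_exists[k kE] (p : arc R) : exists k : node R -> bool,
    ahead p = q -> [/\ k (atail p) = false,
      forall e, Sx e -> e \notin x :: aux -> k (atail e) = k (ahead e)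
      & forall a, Sx a -> a \in aux -> k (ahead a) = eps a].
  (* Being 0 at [n], the function [k] is 0 at [c], [q] and the tail of [p] through [x], [y] and [p],
     and it is [eps a] at the head of each auxiliary port [a] in [Sx]. *)
  have [k k0 kE] := sound_potential (fun e => (e \in aux) && eps e) n (thSp p).
  exists k => hp; split.
  - have nyaux : y \notin aux.
      by apply: contra_eqN labq => /taux; rewrite ty => ->; rewrite labn.
    have npaux : p \notin aux by apply/negP=> /aux_q; rewrite hp eqxx.
    have := kE x; have := kE y; have := kE p.
    rewrite /Sp !inE !eqxx !orbT (negPf nxaux) (negPf nyaux) (negPf npaux).
    rewrite hp eqxx orbT hx hy tx ty k0 => /(_ isT) + /(_ isT) + /(_ isT) /=.
    by case: (k _) (k q) (k c) => -[] [].
  - move=> e Se; rewrite inE negb_or => /andP[_ /negPf nae].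
    have := kE e; rewrite /Sp Se nae => /(_ isT) /=.
    by case: (k _) (k _) => -[].
  - by move=> a Sa aa; have := kE a; rewrite /Sp Sa aa (taux a aa) k0; apply.
(* If [q] has no premise, [K] is constantly true; then every [sel a] is [None] and there is no
   defect to cancel. *)
pose K v := [forall (p | ahead p == q), k p v].
pose h v := f v (+) K v.
pose via_h p := via p (h (atail p)).
have K_tail p : ahead p = q -> K (atail p) = false.
  move=> hp; apply/negbTE/forallPn; exists p.
  by rewrite hp eqxx; have [->] := kE p hp.
have selP a : match sel a with
    | Some p => S (inr (p, a)) /\ ahead p = q
    | None => forall p, ~~ S (inr (p, a)) end.
  rewrite /sel; case: pickP => [p Sp_a | none p]; last by rewrite none.
  by split=> //; have /andP[] := subS _ Sp_a; rewrite inE => /eqP.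
exists (fun v => match v with
  | inl u => h u
  | inr (inl p) => via_h p
  | inr (inr (inl p)) => h (atail p) (+) g (inl p)
  | inr (inr (inr a)) => if sel a is Some p then via_h p (+) g (inr (p, a))
                         else h (ahead a) (+) g (inl a)
  end) => -[e | [p a]] Se /=.
  have := subS _ Se; rewrite /= !inE negb_or => /andP[nex ney].
  have [he | he] := eqVneq (ahead e) q.
    have /negPf-> : e \notin aux by apply/negP=> /aux_q; rewrite he eqxx.
    by rewrite addbA addbb.
  have Sxe : Sx e by rewrite /Sx he.
  have [ae | ae] := boolP (e \in aux); last first.
    have := fE e; rewrite /Sp Sxe => /(_ isT) <-.
    have -> : h (atail e) = f (atail e) (+) K (ahead e).
      congr (_ (+) _); apply: eq_forallb_in => p /eqP hp.
      by have [_ -> //] := kE p hp; rewrite inE negb_or nex.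
    by rewrite addbACA addbb addbF.
  case sel_e: (sel e) (selP e) => [p | ] selPe; last first.
    by rewrite addbC addbA addbb.
  have [_ hp] := selPe.
  have K_e : K (ahead e) = eps e.
    apply/forallP/idP => [/(_ p) | eps_e p'].
      by rewrite hp eqxx; case: (kE p hp) => _ _ ->.
    by apply/implyP=> /eqP hp'; have [_ _ ->] := kE p' hp'.
  rewrite /via_h /h K_e K_tail // /eps sel_e /via addbF.
  by case: (f _) (f _) (g _) (g _) (g _) (g _) => -[] [] [] [] [].
have /andP[_] := subS _ Se; rewrite on mem_rcons inE.
have [aa _ | na] := boolP (a \in aux).
  case: (sel a) (selP a) => [p' [Sp' _] | /(_ p)]; last by rewrite Se.
  have := thS _ _ Se Sp'; rewrite /= aa => /(_ erefl isT) [->].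
  by rewrite addbA addbb.
rewrite orbF => /eqP->; rewrite /via_h /via.
by case: (h _) (g _) (g _) => -[] [].
Qed.

(** Labelling [x] and [y] by 0 makes [f] agree at [m] and [n], so the auxiliary ports of [n] may be
    moved to [m]. *)
Lemma enter_sound (c n m : node R) (aux s1 s2 : seq (arc R)) (x y : arc R) B' :
  ground_structure R -> lab c = Cut -> lab n = Bang -> lab m = Bang ->
  order n = rcons aux x -> ahead x = c -> order m = s1 ++ y :: s2 -> ahead y = c ->
  sound (G := enter_graph m aux s1 s2 B') [pred e | e \notin [:: x; y]].
Proof.
move=> [_ _ ordn _] labc labn labm on hx om hy S subS thS g.
have tailE (v : node R) (e : arc R) : lab v = Bang -> (e \in order v) = (atail e == v).
  by move=> labv; have [_ oE] := ordn v labv; rewrite oE inE.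
have tx : atail x = n by apply/eqP; rewrite -tailE // on mem_rcons inE eqxx.
have ty : atail y = m by apply/eqP; rewrite -tailE // om mem_cat inE eqxx orbT.
have taux e : e \in aux -> atail e = n.
  by move=> ae; apply/eqP; rewrite -tailE // on mem_rcons inE ae orbT.
pose S1 := [pred e | S e || (e \in [:: x; y])].
have thS1 : thin (G := R) S1.
  apply: thin_setU => // e.
  by rewrite !inE => /orP[] /eqP->; rewrite ?hx ?hy labc.
have [f _ fE] := sound_potential (fun e => (e \notin [:: x; y]) && g e) m thS1.
have fmn : f m = f n.
  have := fE x; have := fE y; rewrite /= !inE !eqxx !orbT hx hy tx ty.
  by move=> /(_ isT) + /(_ isT); case: (f m) (f n) (f c) => -[] [].
exists f => e Se; have ne : e \notin [:: x; y] := subS e Se.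
have := fE e; rewrite /= Se ne => /(_ isT) /= <-.
by case: ifP => // ae; rewrite (taux e ae) fmn.
Qed.

End Erasing.

(** The new nodes form a tree hanging from the tail of [d]: first the cut, then [n], then the new
    bullets. Their values are read off in that order. *)
Lemma enter_box_sound (R : prestruct) (n m : node R) (aux : seq (arc R)) (x : arc R)
    (t1 t2 : seq (arc (box m))) (d : arc (box m)) :
  ground_structure (box m) -> sound (G := box m) predT ->
  d \in concls (box m) -> order n = rcons aux x ->
  sound (G := enter_box_graph n aux t1 d t2)
    [pred e | match e with inl _ => true | inr a => a \in order n end].
Proof.
move=> [_ [_ cE] _ _] sB dc on S subS thS g.
have thB : thin (G := box m) (fun b => S (inl b)).
  move=> b b' Sb Sb' Eb lab_b.
  have nd u : ahead u = ahead b -> (u == d) = false.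
    move=> Eu; apply: contraTF lab_b => /eqP Ed.
    by move: dc; rewrite -Ed cE Eu => /eqP->.
  have := thS (inl b) (inl b') Sb Sb'; rewrite /= !nd // Eb.
  by rewrite -Eb => /(_ erefl lab_b) [].
have [f fE] := sB _ (fun _ _ => isT) thB (fun b => g (inl b)).
pose fc := f (atail d) (+) g (inl d).
pose fn := fc (+) g (inr x).
exists (fun v => match v with
  | inl u => f u
  | inr None => fn
  | inr (Some None) => fc
  | inr (Some (Some a)) => fn (+) g (inr a) end) => -[b | a] Sa /=.
  case: eqP => [-> | _]; last exact: fE.
  by rewrite addbA addbb.
have : a \in order n := subS _ Sa.
rewrite on mem_rcons inE; case: ifP => [_ _ | _]; first by rewrite addbA addbb.
by rewrite orbF => /eqP->; rewrite /fn addbC addbA addbb.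
Qed.

(** * Balance through each step, and preservation *)

Lemma balanced_erase (G : preground) (s : seq (node G)) :
  balanced G -> uniq s ->
  count (fun v => positive (lab v)) s
      + #|[pred v : node G | (v \notin s) && positive (lab v)]|
    = count (fun v => negative (lab v)) s
      + #|[pred v : node G | (v \notin s) && negative (lab v)]| + 1.
Proof. by move=> bal us; rewrite -!card_erase. Qed.

Lemma balanced_erase_bullet (G : preground) (w : node G) :
  balanced G -> lab w = Bullet ->
  #|[pred v : node G | (v != w) && positive (lab v)]|
    = #|[pred v : node G | (v != w) && negative (lab v)]| + 1.
Proof.
move=> bal labw; have := balanced_erase (s := [:: w]) bal isT.
have erase_w Q : #|[pred v : node G | (v \notin [:: w]) && Q (lab v)]|
    = #|[pred v : node G | (v != w) && Q (lab v)]|.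
  by apply: eq_card => v; rewrite !inE.
by rewrite /= labw (erase_w positive) (erase_w negative).
Qed.

Lemma lab_neq (G : preground) (u v : node G) : lab u != lab v -> u != v.
Proof. by apply: contraNneq => ->. Qed.

(** Balance is tallied as follows. The ax and 1/bot steps erase one positive and one negative node.
    The tensor/par step trades two negative nodes for two cuts. Opening a box trades a [!] node for
    a content of excess one. Duplication trades a cut and a [!] node for equally many of each. The
    !/! step moves such a pair into a box. *)
Lemma cut_step_good R R' : cut_step R R' -> proof_structure R -> good R -> good R'.
Proof.
elim=> {R R'}.
- move=> R R' c m a a0 b labc labm _ ha0 hb ta0 _ _ ta kR' _ [sR bal gb].
  apply: keeping_good kR' _ _ _; first exact: (ax_sound sR labc ha0 hb ta0 ta).
    have us : uniq [:: c; m] by rewrite /= inE lab_neq // labc labm.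
    by have := balanced_erase bal us; rewrite /= labc labm => /addnI.
  by move=> v _; apply: gb.
- move=> R R' c o p x y labc labo labp _ _ _ _ kR' _ [sR bal gb].
  apply: keeping_good kR' _ _ _; first by move=> S _; apply: sR.
    have us : uniq [:: c; o; p].
      by rewrite /= !inE negb_or !lab_neq // ?labc ?labo ?labp.
    by have := balanced_erase bal us; rewrite /= labc labo labp => /addnI.
  by move=> v _; apply: gb.
- move=> R R' c t p x y tl tr pl pr labc labt labp hx hy tx ty ot op kR'.
  move=> [gsR _] [sR bal gb].
  apply: keeping_good kR' _ _ _.
  + exact: (tens_sound sR gsR labc labt labp hx hy tx ty ot op).
  + have us : uniq [:: c; t; p].
      by rewrite /= !inE negb_or !lab_neq // ?labc ?labt ?labp.
    have := balanced_erase bal us; rewrite /= labc labt labp.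
    rewrite !card_sum_pred /= (eq_card0 (A := [pred b : bool | positive Cut])) //.
    by rewrite (eq_cardT (A := [pred b : bool | negative Cut])) // -cardT card_bool; lia.
  + by case=> [v _ | //]; apply: gb.
- move=> R R' c n d aux x y z labc labn labd on hx ty hy hz kR' [gsR psR] [sR bal gb].
  have [psB szB] := psR n labn; have [sB balB gbB] := gb n labn; have [gsB _] := psB.
  apply: keeping_good kR' _ _ _.
  + exact: (open_sound sR gsR gsB sB szB labc labn labd ty hy hz).
  + have us : uniq [:: n; d] by rewrite /= inE lab_neq // labn labd.
    have := balanced_erase bal us; rewrite /= labn labd !card_sum_pred /=.
    (* The bullets of the opened box disappear, but they are neither positive nor negative. *)
    have keepB Q : Q Bullet = false ->
        #|[pred u : node (box n) | (lab u != Bullet) && Q (lab u)]|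
          = #|[pred u : node (box n) | Q (lab u)]|.
      by move=> Q0; apply: eq_card => u; rewrite !inE; case: eqP => // ->; rewrite Q0.
    rewrite (keepB positive) // (keepB negative) // balB; lia.
  + by case=> v _; [apply: gb | apply: gbB].
- move=> R R' c n q aux x y labc labn labq on hx ty hy kR' [gsR _] [sR bal gb].
  apply: keeping_good kR' _ _ _.
  + exact: (dup_sound sR gsR labc labn labq on hx ty hy).
  + have us : uniq [:: c; n; q].
      by rewrite /= !inE negb_or !lab_neq // ?labc ?labn ?labq.
    have := balanced_erase bal us; rewrite /= labc labn labq !card_sum_pred /=.
    have all_prem (b : bool) : #|[pred p | (p \in premises q) && b]| = #|premises q| * b.
      case: b; rewrite ?muln1 ?muln0; last by apply: eq_card0 => p; rewrite !inE andbF.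
      by apply: eq_card => p; rewrite !inE andbT.
    have no_why (b : bool) : b = false -> #|[pred a | (a \in aux) && b]| = 0.
      by move=> ->; apply: eq_card0 => a; rewrite !inE andbF.
    by rewrite !all_prem !no_why //=; lia.
  + by case=> [v _ | [p _ _ | [//|//]]]; [apply: gb | apply: (gb n)].
- move=> R R' B' c n m aux s1 s2 x y t1 t2 d labc labn labm _ on hx om _ hy cm _
    kB' kR' [gsR psR] [sR bal gb].
  have [[gsB _] _] := psR m labm; have [sB balB gbB] := gb m labm.
  have dc : d \in concls (box m) by rewrite cm mem_cat inE eqxx orbT.
  have gB' : good B'.
    apply: keeping_good kB' _ _ _.
    + exact: (enter_box_sound gsB sB dc on).
    + have labd : lab (ahead d) = Bullet.
        by have [_ [_ cE] _ _] := gsB; apply/eqP; rewrite -cE.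
      rewrite !card_sum_pred /= (balanced_erase_bullet balB labd).
      rewrite (@eq_card1 _ None); last by case=> [[a|]|]; rewrite !inE //= andbF.
      rewrite (@eq_card1 _ (Some None)); last first.
        by case=> [[a|]|]; rewrite !inE //= andbF.
      by [].
    + case=> [v | [[a|]|]] _ labv; [exact: gbB | by [] | by [] | exact: gb n labn].
  apply: keeping_good kR' _ _ _.
  + exact: (enter_sound sR gsR labc labn labm on hx om hy).
  + have us : uniq [:: c; n] by rewrite /= inE lab_neq // labc labn.
    by have := balanced_erase bal us; rewrite /= labc labn => /addnI.
  + by move=> v _ labv /=; case: eqP => _; [exact: gB' | exact: gb].
- move=> R R' B' n labn _ IH isoR [gsR psR] [sR bal gb].
  apply: iso_good isoR _; apply: Good => [||v labv]; [exact: sR | exact: bal |].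
  rewrite /=; case: eqP => _; last exact: gb.
  by have [psB _] := psR n labn; exact: IH psB (gb n labn).
Qed.

Theorem theorem11 :
  forall R R' : prestruct,
    proof_structure R -> proof_structure R' ->
    cut_step R R' -> ACCw R -> ACCw R'.
Proof.
move=> R R' psR psR' step /(proof_structure_ACCw psR) gR.
by apply/(proof_structure_ACCw psR'); apply: cut_step_good step psR gR.
Qed.
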